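(* Let $n$ be a positive integer with positive divisors $a$ and $b$, let $g:=(a,b)$, and let $c\in\mathbb{Z}_n$. (i) If $g\nmid c$, then $N_{n;a,b}(c)=0$. (ii) Let $g\mid c$ and set $n':=\frac{n}{g}$, $a':=\frac{a}{g}$, $b':=\frac{b}{g}$ and $c':=\frac{c}{g}$. If $(c',a'b')>1$, then $N_{n;a,b}(c)=0$. If $(c',a'b')=1$, then $$N_{n;a,b}(c)= m\prod_{p\mid m,\ p\mid a'b'}\left(1-\frac1p\right)\prod_{p\mid n',\ p\nmid a'b',\ p\mid c'}\left(1-\frac1p\right)\prod_{p\mid n',\ p\nmid a'b'c'}\left(1-\frac2p\right)=\frac{m}{\mathrm{rad}(m)}\,\varphi(m_1)\,\varphi(m_2)\,\varphi^*(m_3,c'),$$ where all products run over primes $p$, $m:=\frac{n'}{a'b'}$, and $\mathrm{rad}(m)=m_1m_2m_3$ with $m_1\mid a'$, $m_2\mid b'$ and $(m_3,a'b')=1$.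
   Context: $(x,y)$ denotes the greatest common divisor of integers $x,y$. $\mathbb{Z}_n=\mathbb{Z}/n\mathbb{Z}$; an element $c\in\mathbb{Z}_n$ is represented by an integer with $1\le c\le n$, and for $g\mid n$ the condition $g\mid c$ refers to this integer (it is independent of the representative). For a positive divisor $a$ of $n$, $(a)^{\bigstar}:=\{ax:\ 1\le x\le \frac na,\ (x,\frac na)=1\}\subseteq\mathbb{Z}_n$ (the set of generators of the ideal $(a)=a\mathbb{Z}_n$). For divisors $a,b$ of $n$ and $c\in\mathbb{Z}_n$, $$N_{n;a,b}(c):=\#\{(u,v)\in (a)^{\bigstar}\times (b)^{\bigstar}:\ u+v=c\},$$ equivalently the number of pairs of integers $(x,y)$ with $1\le x\le\frac na$, $1\le y\le \frac nb$, $(x,\frac na)=(y,\frac nb)=1$ and $ax+by\equiv c \bmod n$. $\varphi$ is Euler's totient function, $\mathrm{rad}(m)=\prod_{p\mid m}p$ (product over primes) is the squarefree kernel of $m$, and for positive integers $m,k$ $$\varphi^*(m,k):=m\prod_{p\mid m,\ p\mid k}\left(1-\frac1p\right)\prod_{p\mid m,\ p\nmid k}\left(1-\frac2p\right),$$ with products over primes $p$. *)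

(* Defs.v *)
From mathcomp Require Import all_boot all_order all_algebra.

Import GRing.Theory.
Local Open Scope ring_scope.

(* For n > 0 this is the additive group Z/nZ, the trivial group for n = 1      *)
(* included; MathComp's 'Z_n would be Z/2Z in that case. As n need not be      *)
(* syntactically a successor, n.-1.+1 is used to find the zmodType instance.   *)
Notation residue n := 'I_n.-1.+1.

(* The representative in {1, ..., n}, so that the zero class is sent to n.     *)
Definition pos_repr (n : nat) (c : residue n) : nat :=
  if c == 0 then n else c.

(* inZp reduces modulo n.-1.+1; the index x ranges over 1 <= x <= n / a.       *)
Definition ideal_gens (n a : nat) : {set residue n} :=
  [set inZp (a * x)%N | x : 'I_(n %/ a).+1 & (1 <= x)%N && coprime x (n %/ a)].

Definition num_repr (n a b : nat) (c : residue n) : nat :=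
  #|[set uv in setX (ideal_gens n a) (ideal_gens n b) | uv.1 + uv.2 == c]|.

Definition sqfree_kernel (m : nat) : nat := (\prod_(p <- primes m) p)%N.

Definition phi_star (m k : nat) : rat :=
  m%:R * (\prod_(p <- primes m | (p %| k)%N) (1 - 1 / p%:R))
       * (\prod_(p <- primes m | ~~ (p %| k)%N) (1 - 2%:R / p%:R)).

(* Main.v *)
Require Import Defs.
From mathcomp Require Import all_boot all_order all_algebra ring.

Set Implicit Arguments.
Unset Strict Implicit.
Unset Printing Implicit Defensive.

Import GRing.Theory.

(** Write a = gA, b = gB with A, B coprime, and n = gABm. A solution is a pair
    of residues u = ax, v = by with x prime to n/a, y prime to n/b and
    ax + by = c modulo n. Hence g divides c; put c = gC, so that Ax + By = C
    modulo ABm. As x is prime to B and y to A, C is then prime to AB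
    ([coprime_lincomb]). These are the two vanishing statements.

    Conversely let C be prime to AB and fix x0, y0 with Ax0 + By0 = C modulo
    ABm. The solutions of the congruence are x = x0 + Bt, y = y0 - At, where t
    ranges over the residues modulo m; x is automatically prime to B and y to A,
    so what remains is that both be prime to m ([num_repr_param]). This
    condition is local at the primes p dividing m, and the Chinese remainder
    theorem turns the count into m/rad(m) times the product over p of the number
    of admissible t modulo p ([sum_sieve]). Two linear forms must not vanish
    modulo p. If p divides A or B, one of them is a nonzero constant and the
    other has one root; otherwise each has one root, and since
    A(x0 + Bt) + B(y0 - At) = C the roots coincide exactly when p divides C. So
    p - 1 or p - 2 values of t are admissible ([sum_two_linear]).

    Both closed forms of the theorem regroup the resulting product over the
    primes of m ([prod_euler_factor], [prod_euler_factor_split]); for the second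
    one, the primes of m are distributed among those of m1, m2 and m3, and each
    mi is squarefree. *)

(** * Counting with congruence conditions *)

(** The Chinese remainder theorem, as a product formula for sums. *)
Lemma sum_periodic_coprime (k l : nat) (f h : nat -> nat) :
  coprime k l -> (0 < k)%N -> (0 < l)%N ->
  (forall t, f (t %% k) = f t) -> (forall t, h (t %% l) = h t) ->
  (\sum_(t < k * l) f t * h t = (\sum_(i < k) f i) * (\sum_(j < l) h j))%N.
Proof.
move=> co_kl k_gt0 l_gt0 fk hl.
have kl_gt0 : (0 < k * l)%N by rewrite muln_gt0 k_gt0.
rewrite big_distrlr /= pair_big /=.
pose F (u : 'I_k * 'I_l) : 'I_(k * l) :=
  Ordinal (ltn_pmod (chinese k l u.1 u.2) kl_gt0).
have FmodL u : (F u %% k = u.1)%N.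
  by rewrite /= modn_dvdm ?dvdn_mulr // chinese_modl // modn_small.
have FmodR u : (F u %% l = u.2)%N.
  by rewrite /= modn_dvdm ?dvdn_mull // chinese_modr // modn_small.
have Finj : injective F.
  move=> u v eqF; apply/eqP; rewrite -pair_eqE /pair_eq /= -!val_eqE /=.
  by rewrite -!FmodL -!FmodR eqF !eqxx.
have Fbij : bijective F.
  by apply: inj_card_bij => //; rewrite card_prod !card_ord.
rewrite (reindex F) /=; last exact: onW_bij.
by apply: eq_bigr => u _; rewrite -[f (F u)]fk -[h (F u)]hl FmodL FmodR.
Qed.

Lemma sum_periodic_mul (k l : nat) (f : nat -> nat) :
  (forall t, f (t %% k) = f t) ->
  (\sum_(t < k * l) f t = l * \sum_(i < k) f i)%N.
Proof.
move=> fk; elim: l => [|l IHl]; first by rewrite muln0 big_ord0 mul0n.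
rewrite mulnS addnC big_split_ord /= IHl mulSn addnC; congr addn.
by apply: eq_bigr => i _; rewrite -fk mulnC modnMDl fk.
Qed.

Lemma coprime_prime_prod (p : nat) (s : seq nat) :
  prime p -> all prime s -> p \notin s -> coprime p (\prod_(q <- s) q)%N.
Proof.
move=> p_pr; elim: s => [|q s IHs] /=; first by rewrite big_nil coprimen1.
case/andP=> q_pr s_pr; rewrite inE negb_or => /andP[p_neq_q p_notin].
by rewrite big_cons coprimeMr IHs // andbT prime_coprime // dvdn_prime2.
Qed.

Lemma prod_primes_dvd (k : nat) (s : seq nat) :
  uniq s -> all prime s -> all (dvdn^~ k) s -> (\prod_(p <- s) p %| k)%N.
Proof.
elim: s => [|p s IHs] /=; first by rewrite big_nil dvd1n.
case/andP=> p_notin s_uniq /andP[p_pr s_pr] /andP[p_dvd s_dvd].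
by rewrite big_cons Gauss_dvd ?p_dvd ?IHs // coprime_prime_prod.
Qed.

Lemma sum_local_prod (Q : nat -> pred nat) (s : seq nat) :
  uniq s -> all prime s -> (forall p t, Q p (t %% p) = Q p t) ->
  (\sum_(t < \prod_(p <- s) p) all (Q^~ t) s
     = \prod_(p <- s) \sum_(t < p) Q p t)%N.
Proof.
move=> s_uniq s_pr Qmod; elim: s s_uniq s_pr => [|p s IHs] /=.
  by rewrite !big_nil big_ord1.
case/andP=> p_notin s_uniq /andP[p_pr s_pr]; rewrite !big_cons -IHs //.
rewrite -(@sum_periodic_coprime _ _ (fun t => Q p t : nat)
            (fun t => all (Q^~ t) s : nat)).
- by apply: eq_bigr => t _; rewrite mulnb.
- exact: coprime_prime_prod.
- exact: prime_gt0.
- by rewrite big_seq prodn_cond_gt0 // => q /(allP s_pr)/prime_gt0.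
- by move=> t; rewrite Qmod.
move=> t; congr nat_of_bool; apply: eq_in_all => q q_s /=.
rewrite -(Qmod q) modn_dvdm ?Qmod // (big_rem q) //=; exact: dvdn_mulr.
Qed.

Lemma sqfree_kernel_dvd (m : nat) : (sqfree_kernel m %| m)%N.
Proof.
apply: prod_primes_dvd; first exact: primes_uniq.
  exact: all_prime_primes.
by apply/allP => p; rewrite mem_primes => /and3P[].
Qed.

Lemma coprime_all_primes (k m : nat) :
  (0 < m)%N -> coprime k m = all (fun p => ~~ (p %| k)%N) (primes m).
Proof.
move=> m_gt0; apply/idP/allP => [co_km p|no_p].
  rewrite mem_primes => /and3P[p_pr _ p_m].
  by rewrite -prime_coprime // coprime_sym (coprime_dvdr p_m).
have gcd_gt0 : (0 < gcdn k m)%N by rewrite gcdn_gt0 m_gt0 orbT.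
apply: contraT; rewrite /coprime neq_ltn ltnNge gcd_gt0 /= => gcd_gt1.
have pdiv_pr := pdiv_prime gcd_gt1; have := pdiv_dvd (gcdn k m).
rewrite dvdn_gcd => /andP[pdiv_k pdiv_m].
have := no_p (pdiv (gcdn k m)).
by rewrite mem_primes pdiv_pr m_gt0 pdiv_m pdiv_k => /(_ isT).
Qed.

(** The number of t below m that satisfy a condition Q p, depending only on
    t modulo p, at every prime p dividing m. *)
Lemma sum_sieve (Q : nat -> pred nat) (m : nat) :
  (forall p t, Q p (t %% p) = Q p t) ->
  (\sum_(t < m) all (Q^~ t) (primes m)
     = m %/ sqfree_kernel m * \prod_(p <- primes m) \sum_(t < p) Q p t)%N.
Proof.
move=> Qmod; rewrite -(@sum_local_prod Q) ?primes_uniq ?all_prime_primes //.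
rewrite -(@sum_periodic_mul _ _ (fun t => all (Q^~ t) (primes m) : nat)).
  by rewrite mulnC divnK ?sqfree_kernel_dvd.
move=> t; congr nat_of_bool; apply: eq_in_all => q q_m /=.
by rewrite -(Qmod q) modn_dvdm ?Qmod // (big_rem q) //= dvdn_mulr.
Qed.

Lemma eqn_mod_mul2l (d k x y : nat) :
  coprime k d -> (k * x == k * y %[mod d]) = (x == y %[mod d]).
Proof.
move=> co_kd; wlog le_yx : x y / y <= x => [th|].
  by case/orP: (leq_total y x) => /th // xy; rewrite eq_sym xy eq_sym.
by rewrite !eqn_mod_dvd ?leq_mul // -mulnBr Gauss_dvdr // coprime_sym.
Qed.

Lemma sum_linear_root (p B x : nat) :
  (0 < p)%N -> coprime B p -> (\sum_(t < p) (p %| x + B * t) = 1)%N.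
Proof.
case: p => // p _ co_Bp.
pose F (t : 'I_p.+1) : 'I_p.+1 := inord ((x + B * t) %% p.+1).
have FE t : F t = (x + B * t) %% p.+1 :> nat by rewrite inordK ?ltn_pmod.
have Finj : injective F.
  move=> t u /(congr1 val)/eqP; rewrite /= !FE eqn_modDl eqn_mod_mul2l //.
  by rewrite !modn_small // => /eqP/val_inj.
have <- : \sum_(t < p.+1) (t == ord0) = 1.
  by rewrite (bigD1 ord0) //= big1 // => t /negbTE->.
rewrite [RHS](reindex_inj Finj); apply: eq_bigr => t _.
by rewrite -[in RHS]val_eqE /= FE.
Qed.

(** The number of t modulo p at which neither x + Bt nor y - At vanishes.
    The coefficient -A is represented by the natural number Ar, where
    r = -1 modulo p. *)
Lemma sum_two_linear (p A B x y k r : nat) :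
  prime p -> (p %| r.+1)%N -> coprime A B -> (A * x + B * y = k %[mod p])%N ->
  coprime k (A * B) ->
  (\sum_(t < p) (~~ (p %| x + B * t) && ~~ (p %| y + A * r * t)))%N
    = (if (p %| A * B) || (p %| k) then p.-1 else p.-2)%N.
Proof.
move=> p_pr p_r co_AB xy_k co_k.
have p_gt0 := prime_gt0 p_pr.
(* t cancels from this combination, as r + 1 vanishes modulo p *)
have pdvd t : (p %| A * (x + B * t) + B * (y + A * r * t)) = (p %| k).
  have -> : A * (x + B * t) + B * (y + A * r * t)
      = A * x + B * y + r.+1 * (A * B * t).
    by rewrite -addn1; ring.
  by rewrite dvdn_addl ?dvdn_mulr // /dvdn xy_k.
have co_rp : coprime r p by rewrite (coprime_dvdr p_r) // coprimenS.
have no_k : p %| A * B -> ~~ (p %| k).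
  by move=> pAB; rewrite -prime_coprime // coprime_sym (coprime_dvdr pAB).
have noA : p %| A -> forall t, ~~ (p %| y + A * r * t).
  move=> pA t; have := no_k (dvdn_mulr B pA); rewrite -(pdvd t).
  by rewrite dvdn_addr ?(dvdn_mulr _ pA) //; apply/contra/dvdn_mull.
have noB : p %| B -> forall t, ~~ (p %| x + B * t).
  move=> pB t; have := no_k (dvdn_mull A pB); rewrite -(pdvd t).
  by rewrite dvdn_addl ?(dvdn_mulr _ pB) //; apply/contra/dvdn_mull.
have co_of q : ~~ (p %| q) -> coprime q p by rewrite coprime_sym prime_coprime.
have rootB : ~~ (p %| B) -> \sum_(t < p) (p %| x + B * t) = 1.
  by move=> pB; rewrite sum_linear_root // co_of.
have rootA : ~~ (p %| A) -> \sum_(t < p) (p %| y + A * r * t) = 1.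
  by move=> pA; rewrite sum_linear_root // coprimeMl co_of.
have ones : \sum_(t < p) 1 = p by rewrite sum1_card card_ord.
have compl (F : nat -> bool) : \sum_(t < p) ~~ F t + \sum_(t < p) F t = p.
  by rewrite -[RHS]ones -big_split /=; apply: eq_bigr => t _; case: (F t).
rewrite Euclid_dvdM //.
have [pA|pA] := boolP (p %| A) => /=.
  have pB : ~~ (p %| B).
    by rewrite -prime_coprime // (coprime_dvdl pA).
  rewrite -[RHS]subn1 -[in RHS](compl (fun t => p %| x + B * t)) rootB // addnK.
  by apply: eq_bigr => t _; rewrite noA // andbT.
have [pB|pB] := boolP (p %| B) => /=.
  rewrite -[RHS]subn1 -[in RHS](compl (fun t => p %| y + A * r * t)).
  rewrite rootA // addnK.
  by apply: eq_bigr => t _; rewrite noB.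
have pk_iff t : p %| k -> (p %| x + B * t) = (p %| y + A * r * t).
  rewrite -(pdvd t) => dv; apply/idP/idP => pd; move: dv.
    by rewrite dvdn_addr ?(dvdn_mull _ pd) // Euclid_dvdM // (negbTE pB).
  by rewrite dvdn_addl ?(dvdn_mull _ pd) // Euclid_dvdM // (negbTE pA).
case: ifP => pk.
  rewrite -[RHS]subn1 -[in RHS](compl (fun t => p %| x + B * t)) rootB // addnK.
  by apply: eq_bigr => t _; rewrite -pk_iff // andbb.
(* here the two roots are distinct *)
rewrite -[RHS]subn2.
rewrite -[in RHS](compl (fun t => (p %| x + B * t) || (p %| y + A * r * t))).
rewrite [X in _ + X - _](_ : _ = 2) ?addnK.
  by apply: eq_bigr => t _; rewrite negb_or.
rewrite -[2]/(1 + 1) -{1}(rootB pB) -(rootA pA) -big_split /=.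
apply: eq_bigr => t _; case: (boolP (p %| x + B * t)) => px;
  case: (boolP (p %| y + _)) => py //.
by move: pk; rewrite -(pdvd t) dvdn_add ?(dvdn_mull _ px) ?(dvdn_mull _ py).
Qed.

(** * The residue ring and generators of its ideals *)

Section Residue.
Variables (n : nat) (n_gt0 : 0 < n).

Let predK : n.-1.+1 = n := prednK n_gt0.

Lemma residue_lt (u : residue n) : u < n.
Proof. by rewrite -[X in _ < X]predK. Qed.

Lemma inZp_residueE (k : nat) : (inZp k : residue n) = k %% n :> nat.
Proof. by rewrite /= predK. Qed.

Lemma inZp_residue_eq (k l : nat) :
  (inZp k == inZp l :> residue n) = (k == l %[mod n]).
Proof. by rewrite -val_eqE /= predK. Qed.

Lemma inZp_residue_mul (a d k l : nat) : n = a * d -> 0 < a ->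
  (inZp (a * k) == inZp (a * l) :> residue n) = (k == l %[mod d]).
Proof.
by move=> nE a_gt0; rewrite inZp_residue_eq nE -!muln_modr eqn_pmul2l.
Qed.

Lemma inZp_residueD (k l : nat) :
  (inZp k + inZp l = inZp (k + l) :> residue n)%R.
Proof. by apply/val_inj; rewrite /= modnDm. Qed.

Lemma inZp_pos_repr (c : residue n) : inZp (pos_repr n c) = c.
Proof.
apply/val_inj; rewrite [LHS]inZp_residueE /pos_repr; case: eqP => [->|_].
  by rewrite modnn.
by rewrite modn_small ?residue_lt.
Qed.

(** The restriction 1 <= x <= n / a in [ideal_gens] is immaterial. *)
Lemma ideal_gensP (a : nat) (u : residue n) : a %| n ->
  reflect (exists2 x, coprime x (n %/ a) & u = inZp (a * x))
          (u \in ideal_gens n a).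
Proof.
move=> a_n; apply: (iffP imsetP) => [[x]|[x co_x ->]].
  by rewrite inE => /andP[_ co_x] ->; exists x.
have d_gt0 : 0 < n %/ a by rewrite divn_gt0 ?(dvdn_gt0 n_gt0) // dvdn_leq.
set d := n %/ a in co_x d_gt0 *; have nE : n = a * d by rewrite mulnC divnK.
(* the representative of x in {1, ..., d} *)
pose y := if x %% d == 0 then d else x %% d.
have y_mod : y = x %[mod d].
  by rewrite /y; case: eqP => [->|_]; rewrite ?modnn ?modn_mod.
have y_gt0 : 0 < y by rewrite /y; case: eqP => // /eqP; rewrite lt0n.
have y_lt : y < d.+1.
  by rewrite /y; case: eqP => // _; rewrite ltnS ltnW // ltn_pmod.
exists (Ordinal y_lt) => /=.
  by rewrite inE /= y_gt0 -coprime_modl y_mod coprime_modl.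
by apply/eqP; rewrite inZp_residue_eq nE -!muln_modr y_mod.
Qed.

End Residue.

(** * Parametrization of the solutions *)

Lemma coprime_lincomb (A B x y : nat) : coprime A B ->
  coprime (A * x + B * y) (A * B) = coprime x B && coprime y A.
Proof.
move=> co_AB; rewrite coprimeMr andbC; congr andb.
  rewrite -coprime_modl addnC mulnC modnMDl coprime_modl coprimeMl.
  by rewrite co_AB.
by rewrite -coprime_modl mulnC modnMDl coprime_modl coprimeMl coprime_sym co_AB.
Qed.

Lemma num_repr_neq0 (n a b : nat) (c : residue n) :
  0 < n -> a %| n -> b %| n ->
  num_repr n a b c <> 0 ->
  exists x y, [/\ coprime x (n %/ a), coprime y (n %/ b)
     & a * x + b * y = pos_repr n c %[mod n]].
Proof.
move=> n_gt0 a_n b_n /eqP; rewrite -lt0n => /card_gt0P[[u v]].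
rewrite inE in_setX /= => /andP[/andP[]].
move=> /(ideal_gensP n_gt0 _ a_n)[x co_x ->].
move=> /(ideal_gensP n_gt0 _ b_n)[y co_y ->].
rewrite inZp_residueD => xy_c; exists x, y; split=> //; apply/eqP.
by rewrite -inZp_residue_eq // inZp_pos_repr.
Qed.

(** From one solution (x0, y0) of Ax + By = C modulo ABm, all are obtained as
    (x0 + Bt, y0 - At) with t modulo m. In the second component -A is
    represented by the natural number A(m - 1). *)
Lemma num_repr_param (n g A B m C x0 y0 z : nat) (c : residue n) :
  0 < n -> n = g * A * B * m -> coprime A B -> coprime C (A * B) ->
  pos_repr n c = g * C -> A * x0 + B * y0 = C + z * (A * B * m) ->
  num_repr n (g * A) (g * B) c =
    \sum_(t < m) (coprime (x0 + B * t) m && coprime (y0 + A * m.-1 * t) m).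
Proof.
move=> n_gt0 nE co_AB co_C cE xy0.
have := n_gt0; rewrite [in X in X -> _]nE !muln_gt0 -!andbA.
case/and4P=> g_gt0 A_gt0 B_gt0 m_gt0.
have gA_n : g * A %| n by rewrite nE -mulnA dvdn_mulr.
have gB_n : g * B %| n by rewrite nE (mulnAC g) -mulnA dvdn_mulr.
have nA : n %/ (g * A) = B * m by rewrite nE -mulnA mulKn // muln_gt0 g_gt0.
have nB : n %/ (g * B) = A * m.
  by rewrite nE (mulnAC g) -mulnA mulKn // muln_gt0 g_gt0.
pose X t := x0 + B * t; pose Y t := y0 + A * m.-1 * t.
have XY t : A * X t + B * Y t = C + (z + t) * (A * B * m).
  by rewrite mulnDl addnA -xy0 /X /Y -[in RHS](prednK m_gt0) -addn1; ring.
have co_XY t : coprime (X t) B && coprime (Y t) A.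
  rewrite -coprime_lincomb // XY -coprime_modl addnC.
  rewrite (_ : _ * _ = (z + t) * m * (A * B)); last ring.
  by rewrite modnMDl coprime_modl.
pose F (t : 'I_m) : residue n * residue n :=
  (inZp (g * A * X t), inZp (g * B * Y t)).
pose good := [set t : 'I_m | coprime (X t) m && coprime (Y t) m].
have nA' : n = g * A * (B * m) by rewrite nE mulnA.
have nB' : n = g * B * (A * m) by rewrite nE; ring.
have [gA_gt0 gB_gt0] : 0 < g * A /\ 0 < g * B by rewrite !muln_gt0 g_gt0 A_gt0.
have sumF t : (inZp (g * A * X t) + inZp (g * B * Y t) = c :> residue n)%R.
  rewrite inZp_residueD -(inZp_pos_repr n_gt0 c) cE; apply/eqP.
  rewrite inZp_residue_eq // -!mulnA -mulnDr XY mulnDr addnC.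
  by rewrite (_ : g * _ = (z + t) * n) ?modnMDl // nE; ring.
have Finj : injective F.
  move=> t u /(congr1 fst)/eqP.
  rewrite [_ == _](inZp_residue_mul n_gt0 _ _ nA') // eqn_modDl -!muln_modr.
  by rewrite eqn_pmul2l // !modn_small // => /eqP/val_inj.
rewrite /num_repr (_ : [set uv in _ | _] = F @: good).
  rewrite card_imset // -sum1dep_card big_mkcond /=.
  by apply: eq_bigr => t _; case: ifP.
apply/setP=> -[u v]; rewrite inE in_setX /=; apply/idP/imsetP.
  case/andP=> /andP[/(ideal_gensP n_gt0 _ gA_n)[x co_x uE]].
  case/(ideal_gensP n_gt0 _ gB_n) => y co_y vE.
  rewrite nA nB in co_x co_y => /eqP uv_c.
  have [t tm xt] : exists2 t, t < m & x = X t %[mod B * m].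
    have xx0 : x = x0 %[mod B].
      move: uv_c; rewrite uE vE -(sumF 0) !inZp_residueD => /eqP.
      rewrite inZp_residue_eq // -!(mulnA g) -!mulnDr => /eqP.
      move/(congr1 (modn^~ (g * B))); rewrite !modn_dvdm // -!muln_modr.
      move/eqP; rewrite eqn_pmul2l // ![_ + B * _]addnC !(mulnC B) !modnMDl.
      rewrite eqn_mod_mul2l // /X => /eqP ->.
      by rewrite muln0 addn0.
    (* k is x - x0 modulo Bm; the multiple of Bm keeps it natural *)
    pose k := x + B * m * x0 - x0.
    have le_x0 : x0 <= x + B * m * x0.
      by rewrite (leq_trans _ (leq_addl _ _)) // leq_pmull ?muln_gt0 ?B_gt0.
    have kE : x0 + k = x + B * m * x0 by rewrite subnKC.
    have B_k : B %| k.
      by rewrite -eqn_mod_dvd // -mulnA addnC mulnC modnMDl; apply/eqP.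
    exists (k %/ B %% m); first exact: ltn_pmod.
    rewrite /X -modnDmr muln_modr modn_mod modnDmr.
    rewrite [B * (_ %/ _)]mulnC divnK // kE.
    by rewrite addnC [_ * x0]mulnC modnMDl.
  have uE' : u = inZp (g * A * X t).
    by apply/eqP; rewrite uE (inZp_residue_mul n_gt0 _ _ nA') //; apply/eqP.
  have vE' : v = inZp (g * B * Y t).
    by apply: (addrI u); rewrite uv_c [in RHS]uE' sumF.
  have yt : y = Y t %[mod A * m].
    by move/eqP: vE'; rewrite vE (inZp_residue_mul n_gt0 _ _ nB') // => /eqP.
  exists (Ordinal tm); last by rewrite uE' vE'.
  rewrite inE /=; apply/andP; split.
    have: coprime (X t) (B * m) by rewrite -coprime_modl -xt coprime_modl.
    by rewrite coprimeMr => /andP[].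
  have: coprime (Y t) (A * m) by rewrite -coprime_modl -yt coprime_modl.
  by rewrite coprimeMr => /andP[].
case=> t; rewrite inE => /andP[co_X co_Y] [-> ->].
apply/andP; split; first (apply/andP; split).
- apply/ideal_gensP => //; exists (X t); rewrite // nA coprimeMr.
  by case/andP: (co_XY t) => ->.
- apply/ideal_gensP => //; exists (Y t); rewrite // nB coprimeMr.
  by case/andP: (co_XY t) => _ ->.
by rewrite sumF.
Qed.

(** * The squarefree kernel and its factorizations *)

Lemma logn_sqfree_kernel (p m : nat) :
  logn p (sqfree_kernel m) = (p \in primes m).
Proof.
have pr_m := all_prime_primes m; rewrite /sqfree_kernel.
have [p_m | p_m] := boolP (p \in primes m); last first.
  have [p_pr|p_npr] := boolP (prime p); last by rewrite lognE (negbTE p_npr).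
  by rewrite logn_coprime ?coprime_prime_prod.
have p_pr := allP pr_m p p_m; have s_pr q : q \in rem p (primes m) -> prime q.
  by move/mem_rem/(allP pr_m).
rewrite (big_rem p) //= lognM ?(prime_gt0 p_pr) //; last first.
  by rewrite big_seq prodn_cond_gt0 // => q /s_pr/prime_gt0.
rewrite logn_prime // eqxx logn_coprime // coprime_prime_prod //.
  exact/allP.
by rewrite mem_rem_uniqF ?primes_uniq.
Qed.

Lemma sqfree_kernel_gt0 (m : nat) : 0 < sqfree_kernel m.
Proof.
rewrite /sqfree_kernel big_seq prodn_cond_gt0 // => p.
by rewrite mem_primes => /andP[/prime_gt0].
Qed.

Lemma sqfree_kernel_id (m d : nat) :
  d %| sqfree_kernel m -> sqfree_kernel d = d.
Proof.
move=> d_m; have d_gt0 := dvdn_gt0 (sqfree_kernel_gt0 m) d_m.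
rewrite [RHS]prod_prime_decomp // prime_decompE big_map /=.
rewrite /sqfree_kernel !big_seq; apply: eq_bigr => p p_d.
suff -> : logn p d = 1 by rewrite expn1.
apply/eqP; rewrite eqn_leq logn_gt0 p_d andbT.
rewrite (leq_trans (dvdn_leq_log p (sqfree_kernel_gt0 m) d_m)) //.
by rewrite logn_sqfree_kernel leq_b1.
Qed.

Lemma totient_sqfree (d : nat) :
  sqfree_kernel d = d -> totient d = \prod_(p <- primes d) p.-1.
Proof.
move=> dE; have d_gt0 : 0 < d by rewrite -dE sqfree_kernel_gt0.
rewrite totientE // !big_seq; apply: eq_bigr => p p_d.
by rewrite -[in logn p d]dE logn_sqfree_kernel p_d muln1.
Qed.

Lemma perm_primes_coprime3 (m m1 m2 m3 : nat) :
  sqfree_kernel m = m1 * m2 * m3 ->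
  coprime m1 m2 -> coprime m1 m3 -> coprime m2 m3 ->
  perm_eq (primes m) (primes m1 ++ primes m2 ++ primes m3).
Proof.
move=> mE co12 co13 co23.
have := sqfree_kernel_gt0 m; rewrite mE !muln_gt0 -andbA.
case/and3P=> m1_gt0 m2_gt0 m3_gt0.
apply: uniq_perm; first exact: primes_uniq.
  rewrite !cat_uniq !primes_uniq /= has_cat negb_or.
  by rewrite -!coprime_has_primes // co12 co13 co23.
move=> p; rewrite !mem_cat orbA -primesM // -primesM ?muln_gt0 ?m1_gt0 // -mE.
by rewrite -[RHS]logn_gt0 logn_sqfree_kernel lt0b.
Qed.

Lemma big_primes_mul (R : Type) (idx : R) (op : Monoid.com_law idx)
    (k m : nat) (Q : pred nat) (F : nat -> R) : 0 < k -> 0 < m ->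
  \big[op/idx]_(p <- primes (k * m) | ~~ (p %| k) && Q p) F p
    = \big[op/idx]_(p <- primes m | ~~ (p %| k) && Q p) F p.
Proof.
move=> k_gt0 m_gt0; rewrite -!(big_filter_cond _ (fun p => ~~ (p %| k))).
apply: perm_big; apply: uniq_perm; rewrite ?filter_uniq ?primes_uniq // => p.
rewrite !mem_filter primesM // andb_orr [in X in X || _]mem_primes.
by case: (p %| k); rewrite ?andbF.
Qed.

Lemma sqfree_kernel_split (m A B : nat) : coprime A B ->
  exists m1 m2 m3, [/\ sqfree_kernel m = m1 * m2 * m3, m1 %| A, m2 %| B
                     & coprime m3 (A * B)].
Proof.
move=> co_AB.
pose sub (Q : pred nat) := \prod_(p <- [seq p <- primes m | Q p]) p.
have sub_pr Q : all prime [seq p <- primes m | Q p].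
  rewrite all_filter; apply: sub_all (all_prime_primes m) => p p_pr.
  exact/implyP.
exists (sub (dvdn^~ A)), (sub (dvdn^~ B)), (sub (fun p => ~~ (p %| A * B))).
split.
- rewrite /sub !big_filter /sqfree_kernel !(big_mkcond (fun p => _ %| _)).
  rewrite (big_mkcond (fun p => ~~ _)) -!big_split /= !big_seq.
  apply: eq_bigr => p; rewrite mem_primes => /and3P[p_pr _ _].
  rewrite Euclid_dvdM //; have [pA|_] := boolP (p %| A); last first.
    by case: (p %| B); rewrite ?muln1 ?mul1n.
  have /negbTE-> : ~~ (p %| B) by rewrite -prime_coprime // (coprime_dvdl pA).
  by rewrite /= !muln1.
- by apply: prod_primes_dvd; rewrite ?filter_uniq ?primes_uniq ?filter_all.
- by apply: prod_primes_dvd; rewrite ?filter_uniq ?primes_uniq ?filter_all.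
rewrite /sub big_seq; apply: (big_ind (fun k => coprime k (A * B))).
- exact: coprime1n.
- by move=> k l; rewrite coprimeMl => -> ->.
move=> p p_s; rewrite prime_coprime ?(allP (sub_pr _) p p_s) //.
by move: p_s; rewrite mem_filter => /andP[].
Qed.

(** * Euler factors *)

Local Open Scope ring_scope.

(** The proportion of admissible residues modulo p in the count attached to
    D = AB and C. *)
Definition euler_factor (D C p : nat) : rat :=
  if (p %| D)%N || (p %| C)%N then 1 - 1 / p%:R else 1 - 2%:R / p%:R.

Lemma mul_euler_factor (D C p : nat) : prime p ->
  p%:R * euler_factor D C p =
    (if (p %| D) || (p %| C) then p.-1 else p.-2)%N%:R.
Proof.
case: p => [|[|p]] // _; rewrite /euler_factor.
have p_neq0 : p.+2%:R != 0 :> rat by rewrite Num.Theory.pnatr_eq0.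
case: ifP => _ /=; rewrite mulrBr mulr1 mulrCA divff // mulr1.
  by rewrite -[X in X - _]natr1 addrK.
by rewrite -[p.+2]addn2 natrD addrK.
Qed.

(** The count of solutions as a single product over the primes of m. *)
Lemma num_repr_prod (n g A B m C : nat) (c : residue n) :
  (0 < n)%N -> n = (g * A * B * m)%N -> coprime A B -> coprime C (A * B) ->
  pos_repr n c = (g * C)%N ->
  (num_repr n (g * A) (g * B) c)%:R
    = m%:R * \prod_(p <- primes m) euler_factor (A * B) C p.
Proof.
move=> n_gt0 nE co_AB co_C cE.
have := n_gt0; rewrite [in X in X -> _]nE !muln_gt0 -!andbA.
case/and4P=> g_gt0 A_gt0 B_gt0 m_gt0.
have [x0 [y0 [z xy0]]] :
    exists x0 y0 z, (A * x0 + B * y0 = C + z * (A * B * m))%N.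
  (* z represents Ax0; then w = C - z modulo ABm represents By0 *)
  pose z := chinese A B 0 C; pose w := (C + z * (A * B * m).-1)%N.
  have A_z : (A %| z)%N by rewrite /dvdn /z chinese_modl // mod0n.
  have B_w : (B %| w)%N.
    rewrite /dvdn -modnDml -(chinese_modr co_AB 0 C) modnDml -mulnS prednK.
      by rewrite (_ : _ * _ = z * A * m * B)%N ?modnMl //; ring.
    by rewrite !muln_gt0 A_gt0 B_gt0.
  exists (z %/ A)%N, (w %/ B)%N, z.
  rewrite mulnC divnK // mulnC divnK // /w addnCA -mulnS prednK //.
  by rewrite !muln_gt0 A_gt0 B_gt0.
rewrite (num_repr_param n_gt0 nE co_AB co_C cE xy0).
pose Q p t := (~~ (p %| x0 + B * t) && ~~ (p %| y0 + A * m.-1 * t))%N.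
have Qmod p t : Q p (t %% p)%N = Q p t.
  by rewrite /Q /dvdn -!(modnDmr _ (_ * (t %% p))) !modnMmr !modnDmr.
have coprimeQ t :
    coprime (x0 + B * t) m && coprime (y0 + A * m.-1 * t) m
      = all (Q^~ t) (primes m).
  by rewrite !coprime_all_primes // -all_predI.
under [in LHS]eq_bigr do rewrite coprimeQ.
rewrite (sum_sieve m Qmod) // natrM natr_prod.
rewrite -[X in _ = X%:R * _](divnK (sqfree_kernel_dvd m)) natrM.
rewrite [in RHS]natr_prod -mulrA -big_split /=.
congr (_ * _); rewrite !big_seq; apply: eq_bigr => p.
rewrite mem_primes => /and3P[p_pr _ p_m].
rewrite mul_euler_factor // (@sum_two_linear p A B x0 y0 C m.-1) ?prednK //.
apply/eqP; rewrite xy0 addnC; case/dvdnP: p_m => q ->.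
by rewrite !mulnA modnMDl.
Qed.

Lemma prod_euler_factor (D C m : nat) :
  (0 < D)%N -> (0 < m)%N ->
  (\prod_(p <- primes m | (p %| D)%N) (1 - 1 / p%:R))
  * (\prod_(p <- primes (D * m) | ~~ (p %| D)%N && (p %| C)%N) (1 - 1 / p%:R))
  * (\prod_(p <- primes (D * m) | ~~ (p %| D * C)%N) (1 - 2%:R / p%:R))
  = \prod_(p <- primes m) euler_factor D C p.
Proof.
move=> D_gt0 m_gt0.
have -> : \prod_(p <- primes (D * m) | ~~ (p %| D * C)%N)
            (1 - 2%:R / p%:R : rat)
    = \prod_(p <- primes (D * m) | ~~ (p %| D)%N && ~~ (p %| C)%N)
        (1 - 2%:R / p%:R).
  rewrite big_seq_cond [RHS]big_seq_cond; apply: eq_bigl => p.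
  rewrite mem_primes; case: (boolP (prime p)) => //= p_pr.
  by rewrite (Euclid_dvdM D C) // negb_or.
rewrite !big_primes_mul //.
rewrite [X in X * _ * _]big_mkcond [X in _ * X * _]big_mkcond.
rewrite [X in _ * X = _]big_mkcond -!big_split /=.
apply: eq_bigr => p _; rewrite /euler_factor.
by case: (p %| D)%N; case: (p %| C)%N; rewrite /= ?mulr1 ?mul1r.
Qed.

(** Each of phi(m1), phi(m2) and phi*(m3, C) is the product of
    p * euler_factor p over the primes of its argument. *)
Lemma prod_euler_factor_split (A B C m m1 m2 m3 : nat) :
  coprime A B -> sqfree_kernel m = (m1 * m2 * m3)%N ->
  (m1 %| A)%N -> (m2 %| B)%N -> coprime m3 (A * B) ->
  m%:R * \prod_(p <- primes m) euler_factor (A * B) C p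
  = m%:R / (sqfree_kernel m)%:R * (totient m1)%:R * (totient m2)%:R
      * phi_star m3 C.
Proof.
move=> co_AB mE m1_A m2_B co_m3.
have [co_m3A co_m3B] : coprime m3 A /\ coprime m3 B.
  by apply/andP; rewrite -coprimeMr.
have co12 : coprime m1 m2 by rewrite (coprime_dvdl m1_A) // (coprime_dvdr m2_B).
have co13 : coprime m1 m3 by rewrite (coprime_dvdl m1_A) // coprime_sym.
have co23 : coprime m2 m3 by rewrite (coprime_dvdl m2_B) // coprime_sym.
pose W (s : seq nat) := \prod_(p <- s) (p%:R * euler_factor (A * B) C p).
have totientW k : (k %| sqfree_kernel m)%N -> (k %| A * B)%N ->
    (totient k)%:R = W (primes k).
  move=> k_m k_AB.
  rewrite totient_sqfree ?(sqfree_kernel_id k_m) // natr_prod /W !big_seq.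
  apply: eq_bigr => p; rewrite mem_primes => /and3P[p_pr _ p_k].
  by rewrite mul_euler_factor // (dvdn_trans p_k k_AB).
have m3_m : (m3 %| sqfree_kernel m)%N by rewrite mE dvdn_mull.
have phiW : phi_star m3 C = W (primes m3).
  rewrite /phi_star -[in X in X * _ * _](sqfree_kernel_id m3_m) natr_prod -mulrA.
  rewrite /W big_split /=; congr (_ * _).
  rewrite [X in X * _]big_mkcond [X in _ * X]big_mkcond.
  rewrite -big_split /= !big_seq; apply: eq_bigr => p.
  rewrite mem_primes => /and3P[p_pr _ p_m3].
  have /negbTE p_AB : ~~ (p %| A * B)%N.
    by rewrite -prime_coprime // (coprime_dvdl p_m3).
  by rewrite /euler_factor p_AB; case: ifP; rewrite ?mulr1 ?mul1r.
have [m1_m m2_m] : (m1 %| sqfree_kernel m)%N /\ (m2 %| sqfree_kernel m)%N.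
  by rewrite mE -mulnA; split; [|rewrite mulnCA]; apply: dvdn_mulr.
rewrite phiW (totientW _ m1_m (dvdn_mulr _ m1_A)).
rewrite (totientW _ m2_m (dvdn_mull _ m2_B)).
rewrite -!mulrA -!big_cat /= -/(W _).
have -> : W (primes m1 ++ primes m2 ++ primes m3) = W (primes m).
  by apply: perm_big; rewrite perm_sym perm_primes_coprime3.
rewrite /W big_split /= -natr_prod mulKf //.
by rewrite Num.Theory.pnatr_eq0 -lt0n sqfree_kernel_gt0.
Qed.

Theorem theorem3p1 (n a b : nat) (c : residue n)
    (n_gt0 : (0 < n)%N) (a_dvd : (a %| n)%N) (b_dvd : (b %| n)%N) :
  let g := gcdn a b in
  (~~ (g %| pos_repr n c)%N -> num_repr n a b c = 0%N) /\
  ((g %| pos_repr n c)%N ->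
   let n' := (n %/ g)%N in
   let a' := (a %/ g)%N in
   let b' := (b %/ g)%N in
   let c' := (pos_repr n c %/ g)%N in
   ((1 < gcdn c' (a' * b'))%N -> num_repr n a b c = 0%N) /\
   (gcdn c' (a' * b') = 1%N ->
    let m := (n' %/ (a' * b'))%N in
    let P : rat :=
      m%:R
      * (\prod_(p <- primes m | (p %| a' * b')%N) (1 - 1 / p%:R))
      * (\prod_(p <- primes n' | ~~ (p %| a' * b')%N && (p %| c')%N)
           (1 - 1 / p%:R))
      * (\prod_(p <- primes n' | ~~ (p %| a' * b' * c')%N)
           (1 - 2%:R / p%:R)) in
    let splits_rad (m1 m2 m3 : nat) : Prop :=
      [/\ sqfree_kernel m = (m1 * m2 * m3)%N, (m1 %| a')%N, (m2 %| b')%N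
        & coprime m3 (a' * b')] in
    [/\ (num_repr n a b c)%:R = P,
        exists m1 m2 m3 : nat, splits_rad m1 m2 m3
      & forall m1 m2 m3 : nat, splits_rad m1 m2 m3 ->
          P = m%:R / (sqfree_kernel m)%:R * (totient m1)%:R * (totient m2)%:R
              * phi_star m3 c'])).
Proof.
move=> g.
have a_gt0 : (0 < a)%N := dvdn_gt0 n_gt0 a_dvd.
have b_gt0 : (0 < b)%N := dvdn_gt0 n_gt0 b_dvd.
have g_gt0 : (0 < g)%N by rewrite gcdn_gt0 a_gt0.
have aE : a = (g * (a %/ g))%N by rewrite mulnC divnK // dvdn_gcdl.
have bE : b = (g * (b %/ g))%N by rewrite mulnC divnK // dvdn_gcdr.
have g_n : (g %| n)%N := dvdn_trans (dvdn_gcdl a b) a_dvd.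
split=> [g_c | g_c n' A B C].
  apply/eqP; apply: contraNT g_c => /eqP/(num_repr_neq0 n_gt0 a_dvd b_dvd).
  move=> [x [y [_ _ xy]]].
  rewrite /dvdn -(modn_dvdm _ g_n) -xy modn_dvdm // -/(dvdn g _).
  by rewrite dvdn_add // dvdn_mulr // ?dvdn_gcdl ?dvdn_gcdr.
have nE' : n = (g * n')%N by rewrite mulnC divnK.
have cE : pos_repr n c = (g * C)%N by rewrite mulnC divnK.
have co_AB : coprime A B.
  by rewrite /coprime -(eqn_pmul2l g_gt0) muln_gcdr -aE -bE muln1.
have A_n : (A %| n')%N by rewrite -(dvdn_pmul2l g_gt0) -aE -nE'.
have B_n : (B %| n')%N by rewrite -(dvdn_pmul2l g_gt0) -bE -nE'.
have AB_n : (A * B %| n')%N by rewrite Gauss_dvd // A_n.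
split=> [co_C | /eqP co_C m P splits_rad].
  apply/eqP; apply: contraTT co_C => /eqP/(num_repr_neq0 n_gt0 a_dvd b_dvd).
  move=> [x [y [co_x co_y xy]]].
  have xyC : (A * x + B * y = C %[mod n'])%N.
    apply/eqP; rewrite -(eqn_pmul2l g_gt0) !muln_modr -nE' -cE -xy.
    by rewrite mulnDr !mulnA -aE -bE.
  suff /eqP-> : coprime C (A * B) by [].
  rewrite -coprime_modl -(modn_dvdm _ AB_n) -xyC modn_dvdm // coprime_modl.
  have B_na : (B %| n %/ a)%N.
    by rewrite dvdn_divRL // mulnC [in X in (X %| _)%N]aE -mulnA nE' dvdn_pmul2l.
  have A_nb : (A %| n %/ b)%N.
    by rewrite dvdn_divRL // [in X in (X %| _)%N]bE mulnCA nE' dvdn_pmul2l.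
  by rewrite coprime_lincomb // (coprime_dvdr B_na) // (coprime_dvdr A_nb).
have n'E : n' = (A * B * m)%N by rewrite mulnC divnK.
have nE : n = (g * A * B * m)%N by rewrite nE' n'E !mulnA.
have := n_gt0; rewrite [in X in X -> _]nE -!(mulnA g) muln_gt0 g_gt0 /=.
rewrite muln_gt0 => /andP[AB_gt0 m_gt0].
have PE : P = m%:R * \prod_(p <- primes m) euler_factor (A * B) C p.
  by rewrite -prod_euler_factor // !mulrA -n'E.
split.
- by rewrite PE [in LHS]aE [in LHS]bE (num_repr_prod n_gt0 nE co_AB co_C cE).
- exact: sqfree_kernel_split.
move=> m1 m2 m3 [mE m1_A m2_B co_m3]; rewrite PE.
exact: prod_euler_factor_split mE m1_A m2_B co_m3.
Qed.
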